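(* For every unbounded metric space $(X,d)$, the set $\mathcal{M}$ of all minimal closed invariant subsets of $X^\#$ has cardinality $2^{2^{\mathrm{asden}\, X}}$.
   Context: For $x\in X$, $r\geqslant 0$, $A\subseteq X$: $B(x,r)=\{y\in X: d(x,y)\leqslant r\}$ and $B(A,r)=\bigcup_{a\in A}B(a,r)$. A subset $V\subseteq X$ is bounded if $V\subseteq B(x,r)$ for some $x\in X$, $r\geqslant 0$. A subset $L\subseteq X$ is large if $X=B(L,r)$ for some $r\geqslant 0$, and $\mathrm{asden}\,X=\min\{|L|: L \text{ is a large subset of } X\}$. $X$ is endowed with the discrete topology and $\beta X$ is its Stone-Čech compactification, identified with the set of all ultrafilters on $X$; the sets $\{p\in\beta X: A\in p\}$, $A\subseteq X$, form a base of the topology. $X^\#=\{p\in\beta X: \text{each } P\in p \text{ is unbounded in } X\}$, with the subspace topology. For $p,q\in X^\#$ write $p\parallel q$ if there is $r\geqslant 0$ such that $B(Q,r)\in p$ for each $Q\in q$ (this is an equivalence relation, called parallel equivalence). Put $\overline{\overline{p}}=\{q\in X^\#: p\parallel q\}$. A subset $S\subseteq X^\#$ is invariant if $\overline{\overline{p}}\subseteq S$ for each $p\in S$. A minimal closed invariant subset of $X^\#$ is a subset that is minimal by inclusion among the nonempty closed invariant subsets of $X^\#$. *)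

(* Defs.v *)
From HB Require Import structures.
From mathcomp Require Import all_boot all_order all_algebra.
From mathcomp Require Import all_classical all_reals all_analysis.

Set Implicit Arguments.
Unset Strict Implicit.
Unset Printing Implicit Defensive.

Import Order.TTheory GRing.Theory Num.Theory.
Local Open Scope classical_set_scope.
Local Open Scope card_scope.
Local Open Scope ring_scope.

Section MetricSpace.
Context {R : realType} {X : metricType R}.
Implicit Types (x y : X) (A V L : set X) (r : R).

(* The library's [ball] is open and [closed_ball] is its closure; neither is
   the ball {y | d(x,y) <= r} in general. *)
Definition cball x r : set X := [set y | mdist x y <= r].

Definition cnbhd A r : set X := \bigcup_(a in A) cball a r.

Definition mbounded V := exists x r, 0 <= r /\ V `<=` cball x r.

Definition large L := exists2 r, 0 <= r & [set: X] = cnbhd L r.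

End MetricSpace.

Definition least_large {R : realType} (X : metricType R) : set (set X) :=
  [set L | large L /\ forall L' : set X, large L' -> L #<= L'].
Arguments least_large {R} X _.

(* The cardinal min {|L| : L large} is represented by a large subset of X
   whose cardinality is least; the default value set0 is never used, by
   [asdenP]. *)
Definition asden {R : realType} (X : metricType R) : set X :=
  xget set0 (least_large X).
Arguments asden {R} X _.

Lemma exists_least_card (T : Type) (F : set (set T)) :
  F !=set0 -> exists2 L, F L & forall L', F L' -> L #<= L'.
Proof.
move=> [L0 FL0].
have [[L FL L_empty]|Fne] := pselect (exists2 L, F L & L = set0).
  by exists L => // L' _; rewrite L_empty; exact: card_ge0.
pose P (S : set (set T -> T)) :=
  (forall f L, S f -> F L -> L (f L)) /\
  (forall f g L, S f -> S g -> F L -> f L = g L -> f = g).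
have [S [[Sin Sinj] Smax]] : exists S, P S /\ forall B, S `<` B -> ~ P B.
  apply: Zorn_bigcup => G GP Gtot; split=> [f L [S GS Sf]|f g L].
    exact: (GP _ GS).1.
  move=> [S1 GS1 S1f] [S2 GS2 S2g].
  have [S12|S21] := Gtot _ _ GS1 GS2.
    by apply: (GP _ GS2).2 => //; exact: S12.
  by apply: (GP _ GS1).2 => //; exact: S21.
have [L FL LS] : exists2 L, F L & forall x, L x -> exists2 f, S f & f L = x.
  apply: contrapT => noL.
  have /choice[g gP] : forall L, exists x, F L -> L x /\ forall f, S f -> f L <> x.
    move=> L; have [FL|nFL] := pselect (F L); last first.
      have [x _] : L0 !=set0.
        by apply/set0P/eqP => L00; apply: Fne; exists L0.
      by exists x.
    apply: contrapT => nx; apply: noL; exists L => // x Lx.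
    apply: contrapT => nf; apply: nx; exists x => _; split=> // f Sf fLx.
    by apply: nf; exists f.
  have nSg : ~ S g by move=> Sg; have [_ /(_ g Sg)] := gP _ FL0; apply.
  apply: (Smax (S `|` [set g])).
    by split=> [f Sf|sub]; [left|apply: nSg; apply: sub; right].
  split=> [f L [Sf|->] FL|f h L [Sf|->] [Sh|->] FL fh].
  - exact: Sin Sf FL.
  - by have [] := gP _ FL.
  - exact: Sinj Sf Sh FL fh.
  - by have [_ /(_ _ Sf)] := gP _ FL.
  - by have [_ /(_ _ Sh)] := gP _ FL; rewrite fh.
  - by [].
exists L => // L' FL'.
have /choice[h hP] : forall x, exists f, L x -> S f /\ f L = x.
  move=> x; have [/LS[f Sf fx]|nLx] := pselect (L x); first by exists f.
  by exists (fun=> x).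
have hL' x : L x -> L' (h x L') by move=> /hP[Sh _]; exact: Sin Sh FL'.
have hinj : {in L &, injective (fun x => h x L')}.
  move=> x y /set_mem Lx /set_mem Ly hxy.
  have [Shx <-] := hP _ Lx; have [Shy <-] := hP _ Ly.
  by rewrite (Sinj _ _ _ Shx Shy FL' hxy).
have /inj_card_eq/card_esym hLE := hinj.
rewrite (card_le_eql hLE).
by apply: subset_card_le => _ [x Lx <-]; exact: hL'.
Qed.

Lemma asdenP {R : realType} (X : metricType R) : least_large X (asden X).
Proof.
have [|L largeL minL] := @exists_least_card X large.
  exists setT; exists 0 => //; apply/seteqP; split=> // x _.
  by exists x => //; rewrite /cball/= mdistxx.
by apply: xgetPex; exists L.
Qed.

Record ultrafilter (X : Type) := Ultrafilter {
  ultrafilter_sets :> set X -> Prop;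
  ultrafilterP : UltraFilter ultrafilter_sets }.

HB.instance Definition _ (X : Type) := gen_eqMixin (ultrafilter X).
HB.instance Definition _ (X : Type) := gen_choiceMixin (ultrafilter X).

Section StoneCech.
Context {X : Type}.

Definition ultrafilter_base (A : set X) : set (ultrafilter X) :=
  [set p : ultrafilter X | p A].

Lemma ultrafilter_base_cover :
  \bigcup_(A in [set: set X]) ultrafilter_base A = setT.
Proof.
apply/seteqP; split=> // p _; exists setT => //.
by have ? := ultrafilterP p; exact: filterT.
Qed.

Lemma ultrafilter_base_join (A B : set X) (p : ultrafilter X) :
  [set: set X] A -> [set: set X] B ->
  ultrafilter_base A p -> ultrafilter_base B p ->
  exists C, [/\ [set: set X] C, ultrafilter_base C p
    & ultrafilter_base C `<=` ultrafilter_base A `&` ultrafilter_base B].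
Proof.
move=> _ _ pA pB; exists (A `&` B); split=> //.
  by have ? := ultrafilterP p; exact: filterI.
move=> q qAB; have ? := ultrafilterP q.
by split; apply: filterS qAB => x [].
Qed.

HB.instance Definition _ := isBaseTopological.Build (ultrafilter X)
  ultrafilter_base_cover ultrafilter_base_join.

End StoneCech.

(* As a type, [sharp X] carries the subspace topology. *)
Definition sharp {R : realType} (X : metricType R) : set (ultrafilter X) :=
  [set p : ultrafilter X | forall P, p P -> ~ mbounded P].
Arguments sharp {R} X _.

Section Sharp.
Context {R : realType} {X : metricType R}.
Implicit Types (p q : sharp X) (S : set (sharp X)).

Definition parallel p q :=
  exists2 r : R, 0 <= r & forall Q, \val q Q -> \val p (cnbhd Q r).

Definition parallel_class p : set (sharp X) := [set q | parallel p q].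

Definition invariant S := forall p, S p -> parallel_class p `<=` S.

Definition closed_invariant S := [/\ S !=set0, closed S & invariant S].

Definition minimal_closed_invariant S :=
  closed_invariant S /\ forall S', closed_invariant S' -> S' `<=` S -> S' = S.

End Sharp.

(* Main.v *)
(* Write k = asden X and let L be a large set of size k.

   Moving points by a bounded distance onto L shows that every closed invariant
   set contains an ultrafilter carried by L; distinct minimal closed invariant
   sets are disjoint, so there are at most 2^2^k of them.

   Conversely, maximal r-separated sets outside a ball are large, hence of size
   at least k. This yields points y n t, for t in L and n large depending on t,
   going to infinity with n, such that for A, B disjoint in L the rows
   Y A = {y n t | t in A} and Y B have bounded r-neighbourhoods in common for
   every r. Each ultrafilter u on L gives the nonempty invariant set of the
   unbounded ultrafilters that contain, for some r, the r-neighbourhoods of all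
   Y A with A in u. Its closure contains a minimal closed invariant set, and
   for distinct u these closures are disjoint: the points closer to Y A than to
   the row of the complement of A separate them. By Hausdorff's theorem there
   are 2^2^k ultrafilters on L. *)
Require Import Defs.
From mathcomp Require Import all_boot all_order all_algebra.
From mathcomp Require Import all_classical all_reals all_analysis.
From mathcomp Require Import lra.

Set Implicit Arguments.
Unset Strict Implicit.
Unset Printing Implicit Defensive.

Import Order.TTheory GRing.Theory Num.Theory.
Local Open Scope classical_set_scope.
Local Open Scope card_scope.
Local Open Scope ring_scope.

#[local] Existing Instance ultrafilterP.

(** * Comparison of cardinals *)

Lemma card_le_rel {T U : Type} (A : set T) (B : set U) (G : T -> U -> Prop) :
  (forall a, A a -> exists2 b, B b & G a b) ->
  (forall a a' b, A a -> A a' -> G a b -> G a' b -> a = a') -> A #<= B.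
Proof.
move=> GAB Ginj.
have /choice[f Gf] : forall a : A, exists b : B, G (val a) (val b).
  move=> a.
  have [b Bb Gab] := GAB _ (set_valP a).
  by exists (SigSub (mem_set Bb)).
apply/card_leP/injfunPex; exists f => // a a' _ _ faa'.
apply/val_inj/(Ginj _ _ (val (f a))) => //; [exact: set_valP..|].
by rewrite faa'.
Qed.

(** The default [u0] off [A] makes the injection a total function on [T], which avoids subtypes. *)
Lemma card_le_fun {T U : Type} (u0 : U) (A : set T) (B : set U) :
  A #<= B -> exists f : T -> U,
    (forall a, A a -> B (f a)) /\
    forall a a', A a -> A a' -> f a = f a' -> a = a'.
Proof.
move=> /card_leP/injfunPex[f _ finj].
exists (fun a =>
  if pselect (A a) is left Aa then val (f (SigSub (mem_set Aa))) else u0).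
split=> [a Aa|a a' Aa Aa'].
  by case: pselect => // Aa'; exact: set_valP.
case: pselect => // {}Aa; case: pselect => // {}Aa' /val_inj/finj.
by move=> /(_ (mem_set I) (mem_set I))[].
Qed.

(** Of the two copies in the disjoint sum, one has least cardinality. *)
Lemma card_le_total {T U : Type} (A : set T) (B : set U) : A #<= B \/ B #<= A.
Proof.
have inlA : @inl T U @` A #= A by apply: inj_card_eq => x y _ _ [].
have inrB : @inr T U @` B #= B by apply: inj_card_eq => x y _ _ [].
have [|_ [->|->] least] :=
  @exists_least_card (T + U)%type [set @inl T U @` A; @inr T U @` B].
- by exists (@inl T U @` A); left.
- by left; rewrite -(card_le_eql inlA) -(card_le_eqr inrB); apply: least; right.
- by right; rewrite -(card_le_eql inrB) -(card_le_eqr inlA); apply: least; left.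
Qed.

(** * Finite sequences over an infinite set *)

Section SeqCoding.
Context {T : choiceType}.
Implicit Types (s : seq T) (G : set (seq T * T)).

(** Reading the coded set off the one-element sequences makes a coding a single graph, ordered by
    inclusion as Zorn's lemma requires. *)
Let carrier G : set T := [set x | exists y, G ([:: x], y)].

Let over (A : set T) : set (seq T) := [set s | forall x, x \in s -> A x].

(** The proviso [G !=set0] admits the empty graph, the union of the empty chain: [[::]] lies over
    the empty carrier but has no code there. *)
Let coding G :=
  [/\ forall s y, G (s, y) -> over (carrier G) s /\ carrier G y,
      forall s, over (carrier G) s -> G !=set0 -> exists y, G (s, y)
    & forall s s' y, G (s, y) -> G (s', y) -> s = s'].

Let coding_bigcup (F : set (set (seq T * T))) :
  F `<=` coding -> total_on F subset -> coding (\bigcup_(G in F) G).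
Proof.
move=> Fcod Ftot.
have sub_carrier G H : G `<=` H -> carrier G `<=` carrier H.
  by move=> GH x [y Gxy]; exists y; exact: GH.
have carrierU G : F G -> carrier G `<=` carrier (\bigcup_(G in F) G).
  by move=> FG; apply: sub_carrier; exact: bigcup_sup.
split=> [s y [G FG Gsy]|s sU [z [G0 FG0 G0z]]|s s' y [G FG Gsy] [H FH Hsy]].
- have [G1 _ _] := Fcod _ FG; have [sG yG] := G1 _ _ Gsy.
  by split=> [x /sG|]; [|move: yG]; exact: carrierU.
(* A sequence has finitely many entries, so the carrier of one member of the chain contains them
   all. *)
- have [G [FG G0G] sG] : exists2 G, F G /\ G0 `<=` G & over (carrier G) s.
    elim: s sU => [|x s IHs] sU; first by exists G0; first split.
    have [|G [FG G0G] sG] := IHs.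
      by move=> t ts; apply: sU; rewrite inE ts orbT.
    have [y [H FH Hxy]] := sU x (mem_head _ _).
    have [GH|HG] := Ftot _ _ FG FH.
      exists H => [|t].
        by split=> //; exact: subset_trans GH.
      rewrite inE => /predU1P[->|/sG]; first by exists y.
      exact: sub_carrier GH _.
    exists G => // t.
    rewrite inE => /predU1P[->|/sG//]; exists y; exact: HG.
  have [_ + _] := Fcod _ FG => /(_ _ sG)[|y Gsy]; first by exists z; exact: G0G.
  by exists y, G.
- have [GH|HG] := Ftot _ _ FG FH.
    by have [_ _] := Fcod _ FH; apply; [exact: GH Gsy|exact: Hsy].
  by have [_ _] := Fcod _ FG; apply; [exact: Gsy|exact: HG Hsy].
Qed.

(** Ensures that a maximal coding is nonempty. *)
Let nat_coding (h : nat -> T) : injective h ->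
  coding [set p | exists l, p = (map h l, h (pickle l))].
Proof.
move=> hinj.
have carrierE x : carrier [set p | exists l, p = (map h l, h (pickle l))] x
    <-> exists n, x = h n.
  split=> [[y [[|n [|? ?]]//= [-> _]]]|[n ->]]; first by exists n.
  by exists (h (pickle [:: n])), [:: n].
split=> [s y [t [-> ->]]|s sN _|s s' y [t [-> ->]] [t' [-> /hinj]]].
- split=> [x /mapP[n _ ->]|]; apply/carrierE; first by exists n.
  by exists (pickle t).
- have [t ->] : exists t, s = map h t.
    elim: s sN => [|x s IHs] sN; first by exists [::].
    have [|t ->] := IHs; first by move=> z zs; apply: sN; rewrite inE zs orbT.
    have /carrierE[n ->] := sN x (mem_head _ _).
    by exists (n :: t).
  by exists (h (pickle t)), t.
- by move=> /(pcan_inj pickleK) ->.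
Qed.

(* A coding of the sequences over A by elements of A extends to a disjoint
   copy B of A, because seq (A + B) embeds in seq (seq A). *)
Lemma infinite_seq_inj :
  infinite_set [set: T] -> exists c : seq T -> T, injective c.
Proof.
move=> Tinf; have [t0 _] := infinite_setN0 Tinf.
have [h hinj] : exists h : nat -> T, injective h.
  have /infiniteP/(card_le_fun t0)[h [_ hinj]] := Tinf.
  by exists h => m n; exact: hinj.
have [G [Gcod Gmax]] := Zorn_bigcup coding_bigcup.
have G0 : G !=set0.
  apply/set0P/eqP => G0; apply: (Gmax _ _ (nat_coding hinj)).
  rewrite G0; split; first exact: sub0set.
  by move=> /(_ (map h [::], h (pickle [::]))); apply; exists [::].
have [Gran Gdom Ginj] := Gcod.
pose A := carrier G.
have [a0 Aa0] : A !=set0 by have [[s y] /Gran[_ ?]] := G0; exists y.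
have /choice[c cP] : forall s, exists y, over A s -> G (s, y).
  move=> s; have [sA|nsA] := pselect (over A s); last by exists t0.
  by have [y Gsy] := Gdom s sA G0; exists y.
have cA s : over A s -> A (c s) by move=> /cP/Gran[].
have cinj s s' : over A s -> over A s' -> c s = c s' -> s = s'.
  by move=> /cP sA /cP s'A css'; apply: Ginj sA _; rewrite css'.
have extend (B : set T) (g : T -> T) :
    (forall b, B b -> A (g b)) ->
    (forall b b', B b -> B b' -> g b = g b' -> b = b') ->
    exists k : seq T -> T, (forall s, over (A `|` B) s -> A (k s)) /\
      forall s s', over (A `|` B) s -> over (A `|` B) s' ->
        k s = k s' -> s = s'.
  move=> gA ginj.
  (* Length one or two tells the elements of [A] from those of [B]. *)
  pose e x := if x \in A then [:: x] else [:: g x; g x].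
  have eA x : (A `|` B) x -> over A (e x).
    rewrite /e; case: ifPn => [/set_mem Ax _ y|/negP nAx [/mem_set//|Bx] y].
      by rewrite inE => /eqP ->.
    by rewrite !inE orbb => /eqP ->; exact: gA.
  have einj x y : (A `|` B) x -> (A `|` B) y -> e x = e y -> x = y.
    rewrite /e; case: ifPn => [_ _|/negP nAx [/mem_set//|Bx]];
      case: ifPn => [_ _|/negP nAy [/mem_set//|By]] //.
      by move=> [].
    by move=> [/ginj gxy _]; exact: gxy.
  exists (fun s => c (map (c \o e) s)).
  have mapA s : over (A `|` B) s -> over A (map (c \o e) s).
    by move=> sAB _ /mapP[x xs ->]; apply/cA/eA/sAB.
  split=> [s /mapA/cA//|s s' sAB s'AB /cinj].
  move=> /(_ (mapA _ sAB) (mapA _ s'AB)).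
  elim: s sAB s' s'AB => [|x s IHs] sAB [|x' s'] //= s'AB [cexx' ss'].
  congr cons.
    have xAB := sAB _ (mem_head _ _); have x'AB := s'AB _ (mem_head _ _).
    by apply: einj => //; apply: cinj cexx'; exact: eA.
  apply: IHs ss' => t ts; [apply: sAB|apply: s'AB];
    by rewrite inE ts orbT.
(* If the complement of [A] embeds in [A], then [extend] codes all sequences over [T]. Otherwise [A]
   has a copy in its complement, and the coding extends, against maximality. *)
have [AC|CA] := card_le_total A (~` A); last first.
  have [g [gA ginj]] := card_le_fun t0 CA.
  have [k [_ kinj]] := extend _ _ gA ginj.
  by exists k => s s'; apply: kinj => x _; rewrite setUv.
exfalso.
have [g [gC ginj]] := card_le_fun t0 AC.
pose B := g @` A.
have /choice[g' g'P] : forall b, exists a, B b -> A a /\ g a = b.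
  move=> b; have [[a Aa gab]|nBb] := pselect (B b); first by exists a.
  by exists t0.
have [||k [kA kinj]] := extend B g'.
- by move=> b /g'P[].
- by move=> b b' /g'P[_ {2}<-] /g'P[_ {2}<-] ->.
(* Old sequences keep their codes in [A]; [g] carries the codes [k s] of new ones into [B], so the
   two kinds never clash. *)
pose G' := G `|`
  [set p | [/\ over (A `|` B) p.1, ~ over A p.1 & p.2 = g (k p.1)]].
have BnA b : B b -> ~ A b by move=> [a /gC nA <-].
have carrierG' : carrier G' = A `|` B.
  apply/seteqP; split=> [x [y [Gxy|[xAB _ _]]]|x [[y Gxy]|Bx]].
  - by left; exists y.
  - exact: xAB (mem_head _ _).
  - by exists y; left.
  - exists (g (k [:: x])); right; split=> //= [z|/(_ x (mem_head _ _))].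
      by rewrite inE => /eqP ->; right.
    exact: BnA.
apply: (Gmax G').
  split; first by move=> p; left.
  have gB : B (g a0) by exists a0.
  have : carrier G' (g a0) by rewrite carrierG'; right.
  move=> [y G'y] G'G; apply: (BnA _ gB).
  by exists y; exact: G'G.
rewrite /coding carrierG'; split=>
  [s y [/Gran[sA yA]|[/= sAB _ ->]]|s sAB _|s s' y].
- by split=> [x /sA|]; left.
- by split=> //; right; exists (k s) => //; exact: kA.
- have [sA|nsA] := pselect (over A s).
    by have [y Gsy] := Gdom _ sA G0; exists y; left.
  by exists (g (k s)); right.
- have mixed t t' z : G (t, z) -> over (A `|` B) t' -> z = g (k t') -> False.
    by move=> /Gran[_ zA] /kA/gC nA zE; apply: nA; rewrite -zE.
  move=> [Gs|[/= sAB _ yE]] [Gs'|[/= s'AB _ yE']].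
  + exact: Ginj Gs Gs'.
  + by have := mixed _ _ _ Gs s'AB yE'.
  + by have := mixed _ _ _ Gs' sAB yE.
  + apply: kinj => //; apply: ginj; [exact: kA..|].
    by rewrite -yE.
Qed.

End SeqCoding.

(** * Ultrafilters and Hausdorff's theorem *)

Section Ultrafilters.
Context {X : Type}.
Implicit Types (p q : ultrafilter X) (A : set X).

Lemma ultrafilter_inj p q : (forall A, p A <-> q A) -> p = q.
Proof.
case: p q => [p pU] [q qU] /= pq.
have E : p = q by apply/funext => A; apply/propext.
by rewrite E in pU *; congr Ultrafilter; exact: Prop_irrelevance.
Qed.

Lemma ultrafilterC p A : p (~` A) <-> ~ p A.
Proof.
split=> [pnA pA|npA]; last by have [] := in_ultra_setVsetC A (ultrafilterP p).
have : p (A `&` ~` A) by exact: filterI.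
by rewrite setICr; exact: filter_not_empty.
Qed.

Lemma ultrafilter_extend (F : set_system X) :
  ProperFilter F -> exists p : ultrafilter X, F `<=` p.
Proof. by move=> /ultraFilterLemma[G [GU FG]]; exists (Ultrafilter GU). Qed.

Lemma UltraFilter_fmap (Y : Type) (f : X -> Y) p : UltraFilter (fmap f p).
Proof.
split=> [|G GF fpG]; first exact: fmap_proper_filter.
apply/seteqP; split=> // A GA; apply: contrapT => /ultrafilterC pnA.
have GnA : G (~` A) by exact: fpG.
have : G (A `&` ~` A) by exact: filterI.
by rewrite setICr; exact: filter_not_empty.
Qed.

Definition ultrafilter_image (Y : Type) (f : X -> Y) p : ultrafilter Y :=
  Ultrafilter (UltraFilter_fmap f p).

End Ultrafilters.

(* Hausdorff's theorem: coding a pair (s, F), of a sequence in T and a sequence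
   of sequences in T, by a point of T, the sets
   A i = {(s, F) | the subsequence of s in i belongs to F}, i : set T,
   form an independent family. *)
Lemma ultrafilters_card (T : choiceType) : infinite_set [set: T] ->
  exists u : set (set T) -> ultrafilter T, injective u.
Proof.
move=> Tinf; have [c cinj] := infinite_seq_inj Tinf.
have [t0 _] := infinite_setN0 Tinf.
pose code l := c (map c l).
have code_inj : injective code by apply: inj_comp => //; exact: inj_map.
pose A (i : set T) : set T := [set t | exists s F,
  t = code (s :: F) /\ [seq x <- s | x \in i] \in F].
pose basic (ps qs : seq (set T)) : set T :=
  [set t | (forall i, i \in ps -> A i t) /\ (forall j, j \in qs -> ~ A j t)].
have basic_neq0 ps qs : (forall i, i \in ps -> i \in qs -> False) ->
    basic ps qs !=set0.
  move=> pqs.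
  (* [w] picks a point on which two distinct sets disagree. Listing these points in [s] makes the
     subsequence of [s] in any [j] of [qs] differ from those in the members of [ps]. *)
  have /choice[w wP] : forall ij : set T * set T,
      exists x, ij.1 <> ij.2 -> (x \in ij.1) != (x \in ij.2).
    move=> [i j] /=; apply: contrapT => nx; apply: (nx); exists t0 => ij.
    exfalso; apply: ij; apply/seteqP.
    split=> x /mem_set xi; apply/set_mem; apply: contrapT => /negP nxj;
      by apply: nx; exists x; rewrite xi (negPf nxj).
  pose s := [seq w (i, j) | i <- ps, j <- qs].
  pose F := [seq [seq x <- s | x \in i] | i <- ps].
  exists (code (s :: F)); split=> [i ips|j jqs [s' [F' [/code_inj[<- <-]]]]].
    by exists s, F; split=> //; apply/mapP; exists i.
  move=> /mapP[i ips ji].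
  have ij : i <> j by move=> ij; apply: (pqs j) => //; rewrite -ij.
  have ws : w (i, j) \in s by apply/allpairsP; exists (i, j).
  have := wP (i, j) ij; have := congr1 (fun l => w (i, j) \in l) ji.
  by rewrite /= !mem_filter ws !andbT => ->; rewrite eqxx.
(* An ultrafilter above this filter contains [A i] exactly when [E i], so it determines [E]. *)
pose gen (E : set (set T)) : set_system T := [set P | exists ps qs,
  [/\ forall i, i \in ps -> E i, forall j, j \in qs -> ~ E j
    & basic ps qs `<=` P]].
have genF E : ProperFilter (gen E).
  apply: Build_ProperFilter_ex => [P [ps [qs [psE qsE psqsP]]]|].
    have [|t /psqsP Pt] := basic_neq0 ps qs; last by exists t.
    by move=> i /psE Ei /qsE.
  split=> [|P Q [ps [qs [psE qsE bP]]] [ps' [qs' [psE' qsE' bQ]]]|].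
  - by exists [::], [::].
  - exists (ps ++ ps'), (qs ++ qs'); split=> [i|j|t [At nAt]].
    + by rewrite mem_cat => /orP[/psE|/psE'].
    + by rewrite mem_cat => /orP[/qsE|/qsE'].
    + split; [apply: bP|apply: bQ]; split=> i ii;
        by [apply: At; rewrite mem_cat ii ?orbT
           |apply: nAt; rewrite mem_cat ii ?orbT].
  - move=> P Q PQ [ps [qs [psE qsE bP]]]; exists ps, qs; split=> //.
    exact: subset_trans PQ.
have /choice[u uP] := fun E => ultrafilter_extend (genF E).
have uA E i : u E (A i) <-> E i.
  split=> [uAi|Ei].
    apply: contrapT => nEi; move: uAi; apply/ultrafilterC; apply: uP.
    exists [::], [:: i]; split=> // [j|t [_]]; first by rewrite inE => /eqP ->.
    by apply; rewrite inE.
  apply: uP; exists [:: i], [::]; split=> // [j|t []].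
    by rewrite inE => /eqP ->.
  by move=> + _; apply; rewrite inE.
by exists u => E E' EE'; apply/seteqP; split=> i /uA ui; apply/uA;
  rewrite (EE', esym EE').
Qed.

(** * Closed invariant subsets and the upper bound *)

Section Sharp.
Context {R : realType} {X : metricType R}.
Implicit Types (p q : sharp X) (A V : set X) (S K M : set (sharp X)) (r : R).

Lemma sharpNbounded p V : mbounded V -> ~ \val p V.
Proof. by move=> Vb pV; exact: (set_valP p) pV Vb. Qed.

Lemma sharpCbounded p V : mbounded V -> \val p (~` V).
Proof. by move=> /(sharpNbounded (p := p)) pV; apply/ultrafilterC. Qed.

Lemma closure_sharpP S p :
  closure S p <-> forall A, \val p A -> exists2 q, S q & \val q A.
Proof.
split=> [Sp A pA|Sp U].
  have [|q [Sq qA]] := Sp [set q : sharp X | \val q A]; last by exists q.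
  apply: open_nbhs_nbhs; split=> //.
  exists (ultrafilter_base A) => //; exists [set A] => //.
  by rewrite bigcup_set1.
rewrite nbhsE => -[B [[W [D _ <-] <-] [A DA pA]] BU].
have [q Sq qA] := Sp _ pA.
by exists q; split=> //; apply: BU; exists A.
Qed.

Lemma closed_sharpP S :
  closed S <->
  forall p, (forall A, \val p A -> exists2 q, S q & \val q A) -> S p.
Proof. by split=> cS p Sp; apply: cS; apply/closure_sharpP. Qed.

(** The source of parallel ultrafilters: under a map of bounded displacement, preimages of bounded
    sets are bounded, so the image of [p] stays in [sharp X]. *)
Lemma sharp_image p (g : X -> X) r : 0 <= r -> (forall x, mdist x (g x) <= r) ->
  exists2 q, parallel p q & forall A, \val q A = \val p (g @^-1` A).
Proof.
move=> r0 gr.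
have qP : ultrafilter_image g (\val p) \in sharp X.
  apply/mem_set => V pV [x [s [s0 Vxs]]].
  apply: (@sharpNbounded p _ _ pV).
  exists x, (s + r); split=> [|y /Vxs gy]; first exact: addr_ge0.
  apply: (le_trans (metric_triangle _ (g y) _)).
  by apply: lerD => //; rewrite metric_sym.
exists (SigSub qP) => //.
exists r => // Q; apply: (@filterS _ (\val p)) => x gx; exists (g x) => //.
by rewrite /cball/= metric_sym.
Qed.

Lemma invariant_closure S : Defs.invariant S -> Defs.invariant (closure S).
Proof.
move=> Sinv p /closure_sharpP Sp q [r r0 pq]; apply/closure_sharpP => Q /pq.
move=> /Sp[p' Sp' p'Q].
(* [g] moves [cnbhd Q r] into [Q], so the image of [p'] contains [Q] and is parallel to [p']. *)
have /choice[g gP] : forall x, exists y, mdist x y <= r /\ (cnbhd Q r x -> Q y).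
  move=> x; have [[y Qy xy]|nx] := pselect (cnbhd Q r x).
    by exists y; rewrite metric_sym.
  by exists x; rewrite mdistxx.
have [q' pq' q'E] := @sharp_image p' g r r0 (fun x => (gP x).1).
exists q'; first exact: Sinv pq'.
by rewrite q'E; apply: filterS p'Q => x; exact: (gP x).2.
Qed.

Lemma closed_invariant_closure S :
  S !=set0 -> Defs.invariant S -> closed_invariant (closure S).
Proof.
move=> S0 Sinv; split; [|exact: closed_closure|exact: invariant_closure].
by have [p Sp] := S0; exists p; exact: subset_closure.
Qed.

(** Compactness for chains: the sets common to all ultrafilters of some member form a filter, and
    any ultrafilter above it lies in every member. *)
Lemma closed_chain_neq0 (F : set (set (sharp X))) : F !=set0 ->
  (forall S, F S -> S !=set0 /\ closed S) -> total_on F subset ->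
  \bigcap_(S in F) S !=set0.
Proof.
move=> [S0 FS0] Fcl Ftot.
pose G : set_system X := [set A | exists2 S, F S & forall p, S p -> \val p A].
have GF : ProperFilter G.
  apply: Build_ProperFilter_ex => [A [S FS SA]|].
    have [[p /SA pA] _] := Fcl _ FS; exact: filter_ex pA.
  split=> [|A B [S FS SA] [S' FS' SB]|A B AB [S FS SA]].
  - by exists S0 => // p _; exact: filterT.
  - have [SS'|S'S] := Ftot _ _ FS FS'.
      by exists S => // p Sp; apply: filterI; [exact: SA|exact/SB/SS'].
    by exists S' => // p Sp; apply: filterI; [exact/SA/S'S|exact: SB].
  - by exists S => // p /SA; exact: filterS.
have [p Gp] := ultrafilter_extend GF.
have pX : p \in sharp X.
  apply/mem_set => V pV Vb; move: pV; apply/ultrafilterC; apply: Gp.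
  by exists S0 => // q _; exact: sharpCbounded.
exists (SigSub pX) => S FS; have [_ /closed_sharpP] := Fcl _ FS.
apply=> A /= pA.
apply: contrapT => nSA; move: pA; apply/ultrafilterC; apply: Gp; exists S => //.
by move=> q Sq; apply/ultrafilterC => qA; apply: nSA; exists q.
Qed.

(** Zorn's lemma for unions gives a maximal removable part [C]; what remains of [K] is minimal. *)
Lemma closed_invariant_minimal K : closed_invariant K ->
  exists2 M, minimal_closed_invariant M & M `<=` K.
Proof.
move=> Kci; pose P C := closed_invariant (K `\` C).
have [|C [PC Cmax]] := @Zorn_bigcup _ P.
  (* An empty intersection is everything rather than [K], so the empty chain is treated apart. *)
  move=> F FP Ftot; have [F0|/set0P F0] := eqVneq F set0.
    by rewrite F0 bigcup_set0 /P setD0.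
  have DE : K `\` \bigcup_(C in F) C = \bigcap_(S in [set K `\` C | C in F]) S.
    apply/seteqP; split=> [p [Kp nFp] _ [C FC <-]|p Fp].
      by split=> // Cp; apply: nFp; exists C.
    have [C0 FC0] := F0; split.
      by have [] := Fp (K `\` C0); first by exists C0.
    move=> [C FC Cp]; have [] := Fp (K `\` C); first by exists C.
    by [].
  rewrite /P DE; split.
  - apply: closed_chain_neq0.
    + by have [C0 FC0] := F0; exists (K `\` C0), C0.
    + by move=> _ [C FC <-]; have [] := FP _ FC.
    + move=> _ _ [C FC <-] [C' FC' <-].
      by have [CC'|C'C] := Ftot _ _ FC FC'; [right|left]; exact: setDS.
  - by apply: closed_bigI => _ [C FC <-]; have [] := FP _ FC.
  - move=> p Fp q pq S FS; have [C FC CS] := FS.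
    by have [_ _] := FP _ FC; rewrite CS; apply; [exact: Fp FS|exact: pq].
exists (K `\` C); last by move=> p [].
split=> // S Sci SKC; apply/seteqP; split=> // p [Kp nCp].
apply: contrapT => nSp; apply: (Cmax (~` S)).
  split=> [q Cq Sq|/(_ p nSp)//]; by have [] := SKC _ Sq.
by rewrite /P setDE setCK setIidr// => q /SKC[].
Qed.

(** The intersection is closed and invariant, hence equal to both sets by minimality. *)
Lemma minimal_closed_invariant_eq M M' p : minimal_closed_invariant M ->
  minimal_closed_invariant M' -> M p -> M' p -> M = M'.
Proof.
move=> [[_ Mcl Minv] Mmin] [[_ M'cl M'inv] M'min] Mp M'p.
have MM' : closed_invariant (M `&` M').
  split; [by exists p|exact: closedI|move=> q [Mq M'q] q' qq'].
  by split; [exact: Minv qq'|exact: M'inv qq'].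
rewrite -(Mmin _ MM'); last by move=> q [].
by apply: M'min => // q [].
Qed.

Lemma minimal_closed_invariant_card_le (L : set X) : large L ->
  [set M : set (sharp X) | minimal_closed_invariant M] #<= [set: set (set L)].
Proof.
move=> [r r0 Llarge].
have /choice[g gP] : forall x, exists y, L y /\ mdist x y <= r.
  move=> x; have [y Ly xy] : cnbhd L r x by rewrite -Llarge.
  by exists y; rewrite metric_sym.
(* The trace on [L] determines an ultrafilter carried by [L], and hence the minimal set containing
   it. *)
pose trace p : set (set L) := [set A | \val p (\val @` A)].
apply: (@card_le_rel _ _ _ _ (fun M E =>
  exists p, [/\ M p, \val p L & E = trace p])) => [M [[[p Mp] _ Minv] _]|].
  have [q pq qE] := @sharp_image p g r r0 (fun x => (gP x).2).
  exists (trace q) => //; exists q; split=> //; first exact: Minv pq.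
  rewrite qE; suff -> : g @^-1` L = setT by exact: filterT.
  by apply/seteqP; split=> // x _; exact: (gP x).1.
move=> M M' E Mmin M'min [p [Mp pL ->]] [q [M'q qL pq]].
apply: (minimal_closed_invariant_eq (p := p)) => //.
have pqA A : \val p A -> \val q A.
  move=> pA; have : trace p (\val @^-1` A).
    rewrite /trace/=; apply: (@filterS _ (\val p)) (filterI pL pA) => x [Lx Ax].
    by exists (SigSub (mem_set Lx)).
  by rewrite pq; apply: (@filterS _ (\val q)) => _ [x Ax <-].
suff -> : p = q by [].
apply/val_inj/ultrafilter_inj => A; split; first exact: pqA.
by move=> qA; apply: contrapT => /ultrafilterC/pqA/ultrafilterC; apply.
Qed.

End Sharp.

(** * Separated sets and the thin family *)

Section Separated.
Context {R : realType} {X : metricType R}.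
Implicit Types (x y : X) (A N V L : set X) (r s : R).

Definition separated r N := forall x y, N x -> N y -> x <> y -> r < mdist x y.

Lemma mboundedP x V : mbounded V <-> exists n : nat, V `<=` cball x n%:R.
Proof.
split=> [[z [r [r0 Vzr]]]|[n Vxn]]; last by exists x, n%:R; rewrite ler0n.
exists (Num.truncn (mdist x z + r)).+1 => y /Vzr zy.
apply: le_trans (metric_triangle _ z _) _; apply: le_trans (ltW (truncnS_gt _)).
by rewrite lerD2l.
Qed.

Lemma finite_mbounded x V : finite_set V -> mbounded V.
Proof.
move=> /finite_seqP[l ->]; apply/(mboundedP x).
elim: l => [|z l [n ln]]; first by exists 0%N.
exists (maxn n (Num.truncn (mdist x z)).+1) => y /=.
rewrite inE => /predU1P[->|/ln ny].
  by apply: le_trans (ltW (truncnS_gt _)) _; rewrite ler_nat leq_maxr.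
by apply: le_trans ny _; rewrite ler_nat leq_maxl.
Qed.

Context (X_unbounded : ~ mbounded [set: X]).

Lemma large_infinite (x : X) L : large L -> infinite_set L.
Proof.
move=> [r r0 LX] /(finite_mbounded x)[y [s [s0 Lys]]]; apply: X_unbounded.
exists y, (s + r); split; first exact: addr_ge0.
rewrite LX => z [a /Lys ya az].
by apply: le_trans (metric_triangle _ a _) _; exact: lerD.
Qed.

(** By maximality every point outside [V] is within [r] of [N]; as [V] is bounded, one point [z] of
    [N] reaches all of it. *)
Lemma separated_large r V : 0 <= r -> mbounded V ->
  exists N, [/\ N `<=` ~` V, separated r N & large N].
Proof.
move=> r0 [x0 [s [s0 Vs]]].
have [|N [[NV Nsep] Nmax]] :=
  @Zorn_bigcup X (fun N => N `<=` ~` V /\ separated r N).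
  move=> F FP Ftot; split=> [x [N FN Nx]|x y [N FN Nx] [N' FN' N'y]].
    exact: (FP _ FN).1 Nx.
  have [NN'|N'N] := Ftot _ _ FN FN'.
    exact: (FP _ FN').2 (NN' _ Nx) N'y.
  exact: (FP _ FN).2 Nx (N'N _ N'y).
have near y : ~ V y -> exists2 x, N x & mdist x y <= r.
  move=> nVy; apply: contrapT => ny.
  have nNy : ~ N y by move=> Ny; apply: ny; exists y; rewrite ?mdistxx.
  have far x : N x -> r < mdist x y.
    by move=> Nx; rewrite ltNge; apply/negP => xy; apply: ny; exists x.
  apply: (Nmax (N `|` [set y])).
    by split; [exact: subsetUl|move=> /(_ y)Ny; apply/nNy/Ny; right].
  split=> [x [/NV//|->//]|x x' [Nx|->] [Nx'|->]] //.
  - exact: Nsep.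
  - by move=> _; exact: far.
  - by move=> _; rewrite metric_sym; exact: far.
have [z Nz] : N !=set0.
  have [y nVy] : ~` V !=set0.
    apply/set0P/eqP => V0; apply: X_unbounded; exists x0, s; split=> //.
    by rewrite -(setCK V) V0 setC0 in Vs.
  by have [x Nx _] := near y nVy; exists x.
exists N; split=> //; exists (r + (mdist z x0 + s)).
  by rewrite !addr_ge0 ?mdist_ge0.
apply/seteqP; split=> // y _.
have [/Vs xy|/near[x Nx xy]] := pselect (V y).
  exists z => //; apply: le_trans (metric_triangle _ x0 _) _.
  by apply: le_trans (lerD (lexx _) xy) _; rewrite lerDr.
by exists x => //; apply: le_trans xy _; rewrite lerDl addr_ge0 ?mdist_ge0.
Qed.

(* Either bounded separated sets far away can be as large as asden X, or some
   separated set N of size asden X has only smaller bounded subsets; T n is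
   then the part of asden X sitting in the n-th ball under asden X -> N. *)
Lemma bounded_separated_cover (x0 : X) : exists T : nat -> set X,
  [/\ forall n, T n `<=` asden X,
      forall x, asden X x -> exists k, forall n, (k <= n)%N -> T n x
    & forall n r V, 0 <= r -> mbounded V ->
      exists N, [/\ N `<=` ~` V, separated r N, mbounded N & T n #<= N]].
Proof.
have [Llarge Lmin] := asdenP X; set L := asden X in Llarge Lmin *.
have [LT|] := pselect (forall r V, 0 <= r -> mbounded V ->
    exists N, [/\ N `<=` ~` V, separated r N, mbounded N & L #<= N]).
  exists (fun=> L); split=> [n x //|x Lx|n]; last exact: LT.
  by exists 0%N.
move=> /existsNP[r0 /existsNP[V0 /not_implyP[r0ge0 /not_implyP[V0b N0]]]].
have [N [NV0 Nsep /Lmin LN]] := separated_large r0ge0 V0b.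
have Nsmall n : ~ (L #<= N `&` cball x0 n%:R).
  move=> LNn; apply: N0; exists (N `&` cball x0 n%:R); split=> //.
  - by move=> x [/NV0].
  - by move=> x y [Nx _] [Ny _]; exact: Nsep.
  - by apply/(mboundedP x0); exists n => x [].
have [g [gN ginj]] := card_le_fun x0 LN.
pose T n := [set x | L x /\ mdist x0 (g x) <= n%:R].
have TN n : T n #<= N `&` cball x0 n%:R.
  apply: (@card_le_rel _ _ _ _ (fun x y => y = g x)) => [x [Lx gx]|].
    by exists (g x) => //; split=> //; exact: gN.
  by move=> x x' y [Lx _] [Lx' _] ->; exact: ginj.
exists T; split=> [n x []//|x Lx|n r V rge0 Vb].
  exists (Num.truncn (mdist x0 (g x))).+1 => n xn; split=> //.
  by apply: le_trans (ltW (truncnS_gt _)) _; rewrite ler_nat.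
have [N' [N'V N'sep /Lmin LN']] := separated_large rge0 Vb.
suff [A [AN' Ab TA]] : exists A, [/\ A `<=` N', mbounded A & T n #<= A].
  exists A; split=> //; first exact: subset_trans N'V.
  by move=> x y /AN' N'x /AN' N'y; exact: N'sep.
have [Tfin|Tinf] := pselect (finite_set (T n)).
  have [h [hN' hinj]] := card_le_fun x0 LN'.
  exists (h @` T n); split=> [_ [x [Lx _] <-]||].
  - exact: hN'.
  - by apply/(finite_mbounded x0)/finite_image.
  - apply: (@card_le_rel _ _ _ _ (fun x y => y = h x)) => [x Tx|].
      by exists (h x) => //; exists x.
    by move=> x x' y [Lx _] [Lx' _] ->; exact: hinj.
(* Otherwise each ball meets [N'] in at most as many points as [T n] has. Then [N'], a countable
   union of such pieces, injects into [T n], and so [L] into a bounded part of [N]. *)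
apply: contrapT => noA.
have N'T k : N' `&` cball x0 k%:R #<= [set: T n].
  rewrite (card_le_eqr (card_setT _)).
  have [TN'|//] := card_le_total (T n) (N' `&` cball x0 k%:R).
  exfalso; apply: noA; exists (N' `&` cball x0 k%:R); split=> //.
  by apply/(mboundedP x0); exists k => x [].
have Tinf' : infinite_set [set: T n].
  by move=> Tfin; apply: Tinf; rewrite -(eq_finite_set (card_setT _)).
have [t0 _] := infinite_setN0 Tinf'.
have /choice[f fP] := fun k => card_le_fun t0 (N'T k).
have [c cinj] := infinite_seq_inj Tinf'.
(* The length of the coded sequence records a ball and its entry the place in that ball; the [.+1]
   makes the sequence nonempty, so that its head can be read. *)
pose i x := (Num.truncn (mdist x0 x)).+1.
have iP x : cball x0 (i x)%:R x by exact/ltW/truncnS_gt.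
apply: (Nsmall n).
apply: card_le_trans LN' (card_le_trans _ (TN n)).
rewrite -(card_le_eqr (card_setT _)).
apply: (@card_le_rel _ _ _ _ (fun x t => t = c (nseq (i x) (f (i x) x)))).
  by move=> x _; exists (c (nseq (i x) (f (i x) x))).
move=> x x' t N'x N'x' -> /cinj ff.
have ii : i x = i x' by have := congr1 size ff; rewrite !size_nseq.
have [_ finj] := fP (i x).
apply: finj; [by split|by split=> //; rewrite ii|].
by have := congr1 (head t0) ff; rewrite /= -/(i x) -/(i x') ii.
Qed.

(** Rows are built recursively: row [n] is taken from an [n]-separated set outside the ball holding
    the earlier rows, with margin [n]. *)
Lemma thin_family (x0 : X) :
  exists (T : nat -> set (asden X)) (y : nat -> asden X -> X),
  [/\ forall t, exists k, forall n, (k <= n)%N -> T n t,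
      forall n m t t', T n t -> T m t' -> t <> t' ->
        n%:R < mdist (y n t) (y m t'),
      forall n, exists r, forall m t,
        (m < n)%N -> T m t -> mdist x0 (y m t) <= r
    & forall n t, T n t -> n%:R < mdist x0 (y n t)].
Proof.
have [T [TL Tev Tsep]] := bounded_separated_cover x0.
have /choice[step stepP] : forall nk : nat * nat, exists kf : nat * (X -> X),
    [/\ (nk.2 <= kf.1)%N,
        forall t, T nk.1 t -> (nk.2 + nk.1)%:R < mdist x0 (kf.2 t) <= kf.1%:R
      & forall t t', T nk.1 t -> T nk.1 t' -> t <> t' ->
          nk.1%:R < mdist (kf.2 t) (kf.2 t')].
  move=> [n k] /=.
  have [||N [NV Nsep /(mboundedP x0)[k' Nk'] /(card_le_fun x0)[f [fN finj]]]] :=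
    Tsep n n%:R (cball x0 (k + n)%:R); first exact: ler0n.
    by apply/(mboundedP x0); exists (k + n)%N.
  exists (maxn k k', f); split=> /= [|t Tt|t t' Tt Tt' tt'].
  - exact: leq_maxl.
  - rewrite ltNge; apply/andP; split; first by apply/negP; exact: NV (fN _ Tt).
    by apply: le_trans (Nk' _ (fN _ Tt)) _; rewrite ler_nat leq_maxr.
  - by apply: Nsep; [exact: fN..|move=> /finj; apply: contra_not tt'; exact].
(* The ball of radius [rad n] about [x0] holds all rows before [n]. *)
pose fix rad n := if n is n'.+1 then (step (n', rad n')).1 else 0%N.
pose y n t := (step (n, rad n)).2 t.
have rad_mono : {homo rad : m n / (m <= n)%N}.
  apply: homo_leq => // [? ? ?|n]; first exact: leq_trans.
  by have [] := stepP (n, rad n).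
have yP n t : T n t -> (rad n + n)%:R < mdist x0 (y n t) <= (rad n.+1)%:R.
  by have [_ + _] := stepP (n, rad n); exact.
have far n m t t' : (n < m)%N -> T n t -> T m t' ->
    m%:R < mdist (y n t) (y m t').
  move=> nm /yP/andP[_ nt] /yP/andP[mt' _].
  have nt' : mdist x0 (y n t) <= (rad m)%:R.
    by apply: le_trans nt _; rewrite ler_nat rad_mono.
  have := metric_triangle x0 (y n t) (y m t'); rewrite natrD in mt'; lra.
exists (fun n => [set t | T n (\val t)]), (fun n t => y n (\val t)).
split=> [t|n m t t' nt mt' tt'|n|n t /yP/andP[+ _]] /=.
- by have [k kP] := Tev _ (set_valP t); exists k.
- have [nm|mn|nm] := ltngtP n m.
  + by apply: lt_trans (far _ _ _ _ nm nt mt'); rewrite ltr_nat.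
  + by rewrite metric_sym; exact: far.
  + rewrite -nm in mt' *; have [_ _] := stepP (n, rad n); apply => //.
    by move=> /val_inj.
- exists (rad n)%:R => m t mn /yP/andP[_ mt]; apply: le_trans mt _.
  by rewrite ler_nat rad_mono.
- by apply: le_lt_trans; rewrite ler_nat leq_addl.
Qed.

End Separated.

(** * From ultrafilters on the index set to minimal sets *)

Section Thin.
Context {R : realType} {X : metricType R} {I : Type}.
Context (x0 : X) (T : nat -> set I) (y : nat -> I -> X).
Context (T_eventually : forall t, exists k, forall n, (k <= n)%N -> T n t).
Context (y_separated : forall n m t t', T n t -> T m t' -> t <> t' ->
  n%:R < mdist (y n t) (y m t')).
Context (y_bounded : forall n, exists r, forall m t,
  (m < n)%N -> T m t -> mdist x0 (y m t) <= r).
Context (y_unbounded : forall n t, T n t -> n%:R < mdist x0 (y n t)).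
Implicit Types (A B : set I) (u v : ultrafilter I) (p q : sharp X) (r : R).

Let points A : set X := [set x | exists n t, [/\ T n t, A t & x = y n t]].

Let lift u : set (sharp X) :=
  [set q : sharp X | exists2 r, 0 <= r &
    forall A, u A -> \val q (cnbhd (points A) r)].

(** If [x] is within [r] of [y n t] and of [y m t'] with [t <> t'], then [n] is below [r + r], which
    leaves finitely many rows, all in one ball. *)
Let points_disjoint A r :
  mbounded (cnbhd (points A) r `&` cnbhd (points (~` A)) r).
Proof.
pose k := (Num.truncn (r + r)).+1.
have [s sP] := y_bounded k.
apply/(mboundedP x0); exists (Num.truncn (s + r)).+1.
move=> x [[_ [n [t [Tt At ->]]]] /= tx [_ [m [t' [Tt' nAt' ->]]]] /= t'x].
apply: le_trans (ltW (truncnS_gt _)).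
apply: le_trans (metric_triangle _ (y n t) _) _; apply: lerD => //.
apply: sP => //; rewrite -(ltr_nat R).
apply: lt_trans (y_separated Tt Tt' _) _.
  by move=> tt'; rewrite tt' in At.
apply: le_lt_trans (truncnS_gt _).
apply: le_trans (metric_triangle _ x _) _.
by apply: lerD => //; rewrite metric_sym.
Qed.

Let lift_neq0 u : lift u !=set0.
Proof.
(* Removing balls forces every ultrafilter above [F] to be unbounded. *)
pose F : set_system X := [set P | exists A (k : nat),
  u A /\ points A `\` cball x0 k%:R `<=` P].
have [|p Fp] := @ultrafilter_extend _ F.
  apply: Build_ProperFilter_ex => [P [A [k [uA AP]]]|].
    have [t At] := filter_ex uA; have [l lP] := T_eventually t.
    (* This row is late enough both to contain [t] and to lie beyond the ball of radius [k]. *)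
    exists (y (maxn k l) t); apply: AP.
    have Tt : T (maxn k l) t by apply: lP; exact: leq_maxr.
    split; first by exists (maxn k l), t.
    apply/negP; rewrite -ltNge; apply: le_lt_trans (y_unbounded Tt).
    by rewrite ler_nat leq_maxl.
  split=> [|P Q [A [k [uA AP]]] [B [l [uB BQ]]]|P Q PQ [A [k [uA AP]]]].
  - by exists setT, 0%N; split=> //; exact: filterT.
  - exists (A `&` B), (maxn k l); split; first exact: filterI.
    move=> x [[n [t [Tt [At Bt] xE]]] /negP]; rewrite -ltNge => xkl.
    split; [apply: AP|apply: BQ];
      (split; first by exists n, t); apply/negP; rewrite -ltNge;
      by apply: le_lt_trans xkl; rewrite ler_nat ?leq_maxl ?leq_maxr.
  - by exists A, k; split=> //; exact: subset_trans PQ.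
have pX : p \in sharp X.
  apply/mem_set => V pV /(mboundedP x0)[k Vk]; move: pV.
  apply/ultrafilterC; apply: Fp; exists setT, k; split; first exact: filterT.
  by move=> x [_ nx] /Vk.
exists (SigSub pX), 0 => // A uA; apply: Fp; exists A, 0%N; split=> // x [Ax _].
by exists x => //; rewrite /cball/= mdistxx.
Qed.

(** If [q] missed the [(r + s)]-neighbourhood of [points A], then [p] would contain the
    [s]-neighbourhood of its complement, which is disjoint from [cnbhd (points A) r]. *)
Let lift_invariant u : Defs.invariant (lift u).
Proof.
move=> p [r r0 pr] q [s s0 pq]; exists (r + s) => [|A uA].
  exact: addr_ge0.
apply: contrapT => /ultrafilterC/pq => pC.
have [x [[a Aa ax] [z nz zx]]] := filter_ex (filterI (pr A uA) pC).
apply: nz; exists a => //.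
apply: le_trans (metric_triangle _ x _) _.
by apply: lerD => //; rewrite metric_sym.
Qed.

(* The points closer to [points A] than to [points (~` A)] form a set lying in
   every ultrafilter of [lift u] and in none of [lift v]. *)
Let closure_lift_inj u v p : closure (lift u) p -> closure (lift v) p -> u = v.
Proof.
move=> /closure_sharpP up /closure_sharpP vp.
have uv A : u A -> v A.
  move=> uA; apply: contrapT => /ultrafilterC vA.
  pose U : set X := [set x | exists2 a, points A a &
    forall b, points (~` A) b -> mdist a x < mdist b x].
  have uU q : lift u q -> \val q U.
    move=> [r r0 /(_ _ uA) qA].
    apply: filterS (filterI qA (sharpCbounded q (points_disjoint A r))).
    move=> x [[a Aa ax] nx]; exists a => // b Ab; rewrite ltNge.
    apply/negP => ba; apply: nx.
    by split; [exists a|exists b => //; exact: le_trans ba ax].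
  have vU q : lift v q -> \val q (~` U).
    move=> [r r0 /(_ _ vA) qA].
    apply: filterS (filterI qA (sharpCbounded q (points_disjoint A r))).
    move=> x [[b Ab bx] nx] [a Aa /(_ b Ab) ab].
    by apply: nx; split;
      [exists a => //; exact: ltW (lt_le_trans ab bx)|exists b].
  have [pU|/ultrafilterC pnU] := pselect (\val p U).
    by have [q /vU/ultrafilterC] := vp _ pU.
  by have [q /uU qU /ultrafilterC] := up _ pnU.
apply: ultrafilter_inj => A; split; first exact: uv.
by move=> vA; apply: contrapT => /ultrafilterC/uv/ultrafilterC; apply.
Qed.

Lemma minimal_closed_invariant_thin : exists M : ultrafilter I -> set (sharp X),
  (forall u, minimal_closed_invariant (M u)) /\ injective M.
Proof.
have /choice[M MP] : forall u, exists M,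
    minimal_closed_invariant M /\ M `<=` closure (lift u).
  move=> u; have [|M Mmin MS] :=
    @closed_invariant_minimal _ _ (closure (lift u)).
    exact: closed_invariant_closure.
  by exists M.
exists M; split=> [u|u v Muv]; first exact: (MP u).1.
have [[[[p Mp] _ _] _] Mu] := MP u; have [_ Mv] := MP v.
by apply: (closure_lift_inj (p := p)); [exact: Mu|apply: Mv; rewrite -Muv].
Qed.

End Thin.

Theorem corollary3p1 (R : realType) (X : metricType R)
    (X_nonempty : [set: X] !=set0) (X_unbounded : ~ mbounded [set: X]) :
  [set S : set (sharp X) | minimal_closed_invariant S] #=
  [set: set (set (asden X))].
Proof.
have [x0 _] := X_nonempty; have [Llarge _] := asdenP X.
apply/card_eqPle; split; first exact: minimal_closed_invariant_card_le.
have [T [y [Tev ysep ybnd yunb]]] := thin_family X_unbounded x0.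
have [M [Mmin Minj]] := minimal_closed_invariant_thin Tev ysep ybnd yunb.
have [|u uinj] := @ultrafilters_card (asden X).
  move=> Lfin; apply: (large_infinite X_unbounded x0 Llarge).
  by rewrite -(eq_finite_set (card_setT _)).
apply: (@card_le_rel _ _ _ _ (fun E S => S = M (u E))) => [E _|E E' S _ _ ->].
  by exists (M (u E)) => //; exact: Mmin.
by move=> /Minj/uinj.
Qed.
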